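(* There exists a constant $c>0$ such that the $k\times k$ grid $P_k\,\square\,P_k$ satisfies $\mathcal{D}(P_k\,\square\,P_k,\mathcal{T}_n)\ge ck$, where $n=k^2$; i.e. for every labeling $f$ of the edges of $P_k\,\square\,P_k$ by $\{-1,1\}$ there is a spanning tree $T$ with $\left|\sum_{e\in E(T)}f(e)\right|\ge ck$.
   Context: $P_k$ is the path on $k$ vertices and $\square$ is the Cartesian product of graphs, so $P_k\,\square\,P_k$ is the $k\times k$ grid graph with $k^2$ vertices. For a graph $G$, a family $\mathcal{S}_G$ of subgraphs of $G$ and $f:E(G)\to\{-1,1\}$, put $f(S)=\sum_{e\in E(S)}f(e)$ for $S\in\mathcal{S}_G$; the discrepancy is $\mathcal{D}(G,\mathcal{S}_G)=\min_f\max_{S\in\mathcal{S}_G}|f(S)|$, the minimum being over all $f:E(G)\to\{-1,1\}$. $\mathcal{T}_n$ is the set of spanning trees of $G$, where $n$ is the number of vertices of $G$.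
   Formalization: The claim is stated for all k ≥ 2: for k = 1 the grid is a single vertex with no edges, so its discrepancy is 0 and the bound 0 ≥ c fails for every c > 0. *)

(* Defs.v *)
From HB Require Import structures.
From mathcomp Require Import all_boot all_order all_algebra.
From mathcomp Require Import reals.

Set Implicit Arguments.
Unset Strict Implicit.
Unset Printing Implicit Defensive.

Import Order.TTheory GRing.Theory Num.Theory.

Record sgraph := SGraph {
  vertex :> finType;
  adj : rel vertex;
  adj_sym : symmetric adj;
  adj_irrefl : irreflexive adj
}.

Definition edge_set (G : sgraph) : {set {set G}} :=
  [set e : {set G} | [exists x, exists y, adj x y && (e == [set x; y])]].

Definition edge (G : sgraph) : finType := {e : {set G} | e \in edge_set G}.

Section Path.
Variable k : nat.

Definition path_adj : rel 'I_k :=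
  [rel i j : 'I_k | (i.+1 == j :> nat) || (j.+1 == i :> nat)].

Lemma path_adj_sym : symmetric path_adj.
Proof. by move=> i j; rewrite /path_adj /= orbC. Qed.

Lemma path_adj_irrefl : irreflexive path_adj.
Proof. by move=> i; rewrite /path_adj /= orbb gtn_eqF. Qed.

Definition path_graph : sgraph := SGraph path_adj_sym path_adj_irrefl.

End Path.

Section CartesianProduct.
Variables G H : sgraph.

Definition box_adj : rel (G * H) :=
  [rel u v : G * H | (u.1 == v.1) && adj u.2 v.2 || (u.2 == v.2) && adj u.1 v.1].

Lemma box_adj_sym : symmetric box_adj.
Proof.
move=> u v; rewrite /box_adj /=.
by rewrite (eq_sym u.1) (eq_sym u.2) (adj_sym u.2) (adj_sym u.1).
Qed.

Lemma box_adj_irrefl : irreflexive box_adj.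
Proof. by move=> u; rewrite /box_adj /= !adj_irrefl !andbF. Qed.

Definition box : sgraph := SGraph box_adj_sym box_adj_irrefl.

End CartesianProduct.

Section Subgraphs.
Variable G : sgraph.

Definition is_subgraph (p : {set G} * {set edge G}) : bool :=
  [forall e in p.2, val e \subset p.1].

Record subgraph := Subgraph {
  subgraph_val : {set G} * {set edge G};
  subgraphP : is_subgraph subgraph_val
}.

HB.instance Definition _ := [isSub for subgraph_val].
HB.instance Definition _ := [Finite of subgraph by <:].

Definition sub_vertices (S : subgraph) : {set G} := (subgraph_val S).1.
Definition sub_edges (S : subgraph) : {set edge G} := (subgraph_val S).2.

Definition sub_adj (S : subgraph) : rel G :=
  [rel x y | [exists e in sub_edges S, val e == [set x; y]]].

Definition sub_connected (S : subgraph) : bool :=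
  [forall x in sub_vertices S, forall y in sub_vertices S,
     connect (sub_adj S) x y].

(* The vertices of a cycle are distinct, so lengths up to #|G| suffice; the   *)
(* condition 2 < n is needed because ucycleb accepts [::] and, for an edge    *)
(* {x, y}, the sequence [:: x; y].                                            *)
Definition sub_acyclic (S : subgraph) : bool :=
  [forall n : 'I_#|G|.+1, forall c : n.-tuple G,
     (2 < n) ==> ~~ ucycleb (sub_adj S) c].

Lemma sub_acyclicP (S : subgraph) :
  reflect (forall c : seq G, 2 < size c -> ~ ucycle (sub_adj S) c)
          (sub_acyclic S).
Proof.
apply: (iffP forallP) => [acyc c c_gt2 ucyc_c | acyc n].
  have c_le : size c < #|G|.+1.
    by case/andP: ucyc_c => _ /card_uniqP <-; rewrite ltnS max_card.
  have /forallP/(_ (in_tuple c)) := acyc (Ordinal c_le).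
  by rewrite /= c_gt2 /= => /negP; apply.
apply/forallP=> c; apply/implyP=> n_gt2; apply/negP; apply: acyc.
by rewrite size_tuple.
Qed.

Definition is_tree (S : subgraph) : bool :=
  [&& sub_vertices S != set0, sub_connected S & sub_acyclic S].

Definition spanning_trees : {set subgraph} :=
  [set S | (sub_vertices S == [set: G]) && is_tree S].

End Subgraphs.

Section Discrepancy.
Local Open Scope ring_scope.
Variable G : sgraph.

Definition label : finType := seq_sub [:: -1; 1 : int].
Definition label1 : label := SeqSub (mem_last (-1) [:: 1 : int]).
Definition labeling : finType := {ffun edge G -> label}.

Definition weight (f : labeling) (S : subgraph G) : int :=
  \sum_(e in sub_edges S) ssval (f e).

Definition max_weight (F : {set subgraph G}) (f : labeling) : nat :=
  \max_(S in F) `|weight f S|%N.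

(* The constant labeling only witnesses that there is something to minimize   *)
(* over. The maximum over an empty family is 0.                               *)
Definition discrepancy (F : {set subgraph G}) : nat :=
  max_weight F [arg min_(f < [ffun=> label1] : labeling) max_weight F f].

Lemma leq_discrepancy (F : {set subgraph G}) (m : nat) : F != set0 ->
  (m <= discrepancy F)%N <->
  (forall f : labeling, exists2 S, S \in F & (m <= `|weight f S|)%N).
Proof.
case/set0Pn=> S0 S0F; rewrite /discrepancy.
case: arg_minnP => // f0 _ f0_min; split=> [m_le f | m_le].
  have F_gt0 : (0 < #|F|)%N by apply/card_gt0P; exists S0.
  have [S SF Smax] := eq_bigmax_cond (fun S => `|weight f S|%N) F_gt0.
  by exists S; rewrite // -Smax (leq_trans m_le) // f0_min.
have [S SF /leq_trans] := m_le f0; apply.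
exact: (@leq_bigmax_cond _ (mem F) (fun S => `|weight f0 S|%N)).
Qed.

End Discrepancy.

(* Main.v *)
(** Let every grid vertex other than a fixed corner choose as parent one of its
two neighbours closer to that corner: every system of choices is a spanning
tree.  Choosing always the larger, or always the smaller, label, one sees that
if all trees have weight at most d in absolute value, then at most d vertices
see two different labels towards a given corner.  Using three corners, all but
2d of the nonzero rows have a single label on their horizontal edges and on the
vertical edges leading up from them, and a column free of exceptions (one exists
unless d is already of order k) forces these labels to agree.  The tree in which
everyone goes left (up in column 0) then has weight of absolute value at least
(k-1)^2 - 4kd, so d is at least k/20. *)

Require Import Defs.
From mathcomp Require Import all_boot all_order all_algebra.
From mathcomp Require Import reals.
From mathcomp Require Import zify ring.

Set Implicit Arguments.
Unset Strict Implicit.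
Unset Printing Implicit Defensive.

Import Order.TTheory GRing.Theory Num.Theory.
Local Open Scope ring_scope.

(** * Spanning trees from parent maps *)

(** The potential [h] drops along [p], so every vertex is led to [r] and no cycle can close. *)
Definition parent_map (G : sgraph) (r : G) (p : G -> G) (h : G -> nat) : Prop :=
  forall v, v != r -> adj v (p v) /\ (h (p v) < h v)%N.

Lemma adj_edge (G : sgraph) (x y : G) : adj x y -> [set x; y] \in edge_set G.
Proof.
by move=> a; rewrite inE; apply/existsP; exists x; apply/existsP; exists y; rewrite a /=.
Qed.

Lemma set2_eq (T : finType) (x y a b : T) : [set x; y] = [set a; b] ->
  (x = a /\ y = b) \/ (x = b /\ y = a).
Proof.
move=> E.
have hx : x \in [set a; b] by rewrite -E !inE eqxx.
have hy : y \in [set a; b] by rewrite -E !inE eqxx orbT.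
have ha : a \in [set x; y] by rewrite E !inE eqxx.
have hb : b \in [set x; y] by rewrite E !inE eqxx orbT.
move: hx hy ha hb; rewrite !inE.
case/orP=> /eqP xE /orP[]/eqP yE; subst; rewrite ?orbb; auto.
  by move=> _ /eqP->; left.
by move=> /eqP->; left.
Qed.

Section ParentTree.
Variables (G : sgraph) (r : G) (p : G -> G) (h : G -> nat).
Hypothesis par : parent_map r p h.

Definition parent_edges : {set edge G} :=
  [set e | [exists v, (v != r) && (val e == [set v; p v])]].

Lemma parent_tree_subproof : is_subgraph ([set: G], parent_edges).
Proof. by apply/forall_inP => e _; apply: subsetT. Qed.

Definition parent_tree : subgraph G := Subgraph parent_tree_subproof.

Lemma parent_adjP (x y : G) :
  reflect ((x != r /\ y = p x) \/ (y != r /\ x = p y)) (sub_adj parent_tree x y).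
Proof.
apply: (iffP existsP) => [[e]|].
  rewrite inE => /andP[/existsP[v /andP[vr /eqP->]] /eqP E].
  by case: (set2_eq E) => [[<- <-]|[<- <-]]; [left|right].
have main v : v != r -> exists e, (e \in parent_edges) && (val e == [set v; p v]).
  move=> vr; have [/adj_edge a _] := par vr.
  exists (exist (fun A => A \in edge_set G) _ a : edge G); rewrite /= eqxx andbT inE.
  by apply/existsP; exists v; rewrite vr /=.
by case=> [[xr ->]|[yr ->]]; last rewrite setUC; apply: main.
Qed.

Lemma parent_adj_sym : symmetric (sub_adj parent_tree).
Proof.
by move=> x y; apply/parent_adjP/parent_adjP; case=> [[? ?]|[? ?]]; auto.
Qed.

Lemma connect_root (v : G) : connect (sub_adj parent_tree) v r.
Proof.
have [n] := ubnP (h v); elim: n v => // n IH v hv.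
have [->|vr] := eqVneq v r; first exact: connect0.
have [_ lth] := par vr.
apply: (@connect_trans _ _ (p v)); last by apply: IH; lia.
by apply/connect1/parent_adjP; left.
Qed.

(** Every tree edge joins a vertex to a strictly lower parent. *)
Lemma parent_adj_max (x y : G) :
  sub_adj parent_tree x y -> (h y <= h x)%N -> y = p x.
Proof.
by case/parent_adjP => [[_ ->]//|[yr ->]]; have [_] := par yr; lia.
Qed.

Lemma parent_tree_spanning : parent_tree \in spanning_trees G.
Proof.
rewrite inE eqxx /=; apply/and3P; split.
- by apply/set0Pn; exists r; rewrite inE.
- apply/forall_inP => x _; apply/forall_inP => y _.
  apply: connect_trans (connect_root x) _.
  by rewrite (sym_connect_sym parent_adj_sym) connect_root.
apply/sub_acyclicP => c c_gt2 /andP[cyc unc].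
have [v vc vmax] : exists2 v, v \in c & {in c, forall w, h w <= h v}%N.
  case: c c_gt2 {cyc unc} => // a c _.
  case: (@arg_maxnP _ a (mem (a :: c)) h); first exact: mem_head.
  by move=> v vc vmax; exists v.
(* A highest vertex of the cycle would have its parent as both neighbours. *)
case/rot_to: vc => i s Ers.
move: cyc unc c_gt2; rewrite -(rot_cycle i) -(rot_uniq i) -(size_rot i) Ers.
have {}vmax w : w \in s -> (h w <= h v)%N.
  by move=> ws; apply: vmax; rewrite -(mem_rot i) Ers inE ws orbT.
case/lastP: s vmax {Ers} => // s z; case: s => // y s vmax.
rewrite /= rcons_path last_rcons => /andP[vy /andP[_ zv]].
move=> /and3P[_ ys _] _.
have Ey : y = p v by apply: parent_adj_max vy _; apply: vmax; rewrite inE eqxx.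
have Ez : z = p v.
  apply: parent_adj_max; first by rewrite parent_adj_sym.
  by apply: vmax; rewrite /= inE mem_rcons inE eqxx orbT.
by move: ys; rewrite Ey Ez mem_rcons inE eqxx.
Qed.

End ParentTree.

(** * Labels and weights of parent trees *)

Section Labels.
Variables (G : sgraph) (f : labeling G).

(** The default 0 off the edges lets sums run over vertices without adjacency proofs. *)
Definition set_label (A : {set G}) : int :=
  if insub A is Some e then ssval (f (e : edge G)) else 0.

Definition pair_label (x y : G) : int := set_label [set x; y].

Lemma pair_labelC (x y : G) : pair_label x y = pair_label y x.
Proof. by rewrite /pair_label setUC. Qed.

Lemma pair_labelP (x y : G) : adj x y ->
  pair_label x y = 1 \/ pair_label x y = -1.
Proof.
move=> /adj_edge a; rewrite /pair_label /set_label insubT.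
case: (f _) => z /= ; rewrite !inE.
by case/orP => /eqP->; auto.
Qed.

(** No edge is counted twice: two vertices sharing one would be parents of each other, and [h] would
    drop both ways. *)
Lemma weight_parent_tree (r : G) (p : G -> G) (h : G -> nat) :
  parent_map r p h ->
  weight f (parent_tree r p) = \sum_(v | v != r) pair_label v (p v).
Proof.
move=> par; rewrite /weight.
have -> : \sum_(e in sub_edges (parent_tree r p)) ssval (f e) =
   \sum_(A in [set val e | e in parent_edges r p]) set_label A.
  rewrite big_imset /=; last by move=> ? ? _ _; apply: val_inj.
  by apply: eq_bigr => e _; rewrite /set_label valK.
have -> : [set val e | e in parent_edges r p] =
          [set [set v; p v] | v in [set v | v != r]].
  apply/setP => A; apply/imsetP/imsetP => [[e]|[v]].
    by rewrite inE => /existsP[v /andP[vr /eqP Ee] ->]; exists v; rewrite ?inE.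
  rewrite inE => vr ->; have [/adj_edge a _] := par _ vr.
  exists (exist (fun A => A \in edge_set G) _ a : edge G) => //; rewrite inE.
  by apply/existsP; exists v; rewrite vr /=.
rewrite big_imset /=; first by apply: eq_bigl => v; rewrite inE.
move=> v w; rewrite !inE => vr wr /set2_eq[[]//|[Ev Ew]].
have [_] := par _ vr; have [_] := par _ wr.
by rewrite -Ev Ew; lia.
Qed.

Variable d : nat.
Hypothesis weight_le : forall S, S \in spanning_trees G -> (`|weight f S| <= d)%N.

Lemma parent_sum_le (r : G) (p : G -> G) (h : G -> nat) :
  parent_map r p h -> `|\sum_(v | v != r) pair_label v (p v)| <= d%:Z.
Proof.
move=> par; rewrite -(weight_parent_tree par).
by have := weight_le (parent_tree_spanning par); lia.
Qed.

(* Choosing at every vertex the larger, resp. the smaller, of the two labels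
   gives two trees whose weights differ by twice the number of disagreements. *)
Lemma card_disagree (r : G) (p q : G -> G) (h : G -> nat) :
  parent_map r p h -> parent_map r q h ->
  (#|[set v | (v != r) && (pair_label v (p v) != pair_label v (q v))]| <= d)%N.
Proof.
move=> pp qq.
pose up v := if pair_label v (q v) <= pair_label v (p v) then p v else q v.
pose lo v := if pair_label v (q v) <= pair_label v (p v) then q v else p v.
have U : parent_map r up h.
  by move=> v vr; rewrite /up; case: ifP => _; [apply: pp | apply: qq].
have L : parent_map r lo h.
  by move=> v vr; rewrite /lo; case: ifP => _; [apply: qq | apply: pp].
have := parent_sum_le U; have := parent_sum_le L.
set sl := \sum_(v | _) _; set su := \sum_(v | _) _.
suff : su - sl = 2 * (#|[set v | (v != r) &&
    (pair_label v (p v) != pair_label v (q v))]|%:Z) by lia.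
rewrite /su /sl -sumrB -natz -sum1_card natr_sum mulr_sumr.
under [RHS]eq_bigl => v do rewrite inE.
rewrite big_mkcondr /=; apply: eq_bigr => v vr.
have [/pair_labelP a _] := pp _ vr; have [/pair_labelP b _] := qq _ vr.
move: a b; rewrite /up /lo; case: leP; case: eqVneq => /=; lia.
Qed.

End Labels.

(** * Two steps towards a corner of a product *)

Section BoxParent.
Variables (G H : sgraph) (r : G) (s : H) (p : G -> G) (q : H -> H).
Variables (g : G -> nat) (h : H -> nat).
Hypotheses (parG : parent_map r p g) (parH : parent_map s q h).

(** [parent1] and [parent2] give priority to opposite factors; they can differ only where both steps
    are available. *)
Definition parent1 (v : box G H) : box G H :=
  if v.1 == r then (v.1, q v.2) else (p v.1, v.2).

Definition parent2 (v : box G H) : box G H :=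
  if v.2 == s then (p v.1, v.2) else (v.1, q v.2).

Definition box_height (v : box G H) : nat := (g v.1 + h v.2)%N.

Lemma parent1P : parent_map ((r, s) : box G H) parent1 box_height.
Proof.
move=> [i j]; rewrite /parent1 /box_height /= xpair_eqE.
case: eqVneq => [->|/parG[a lt]] /=; last by rewrite /box_adj /= a eqxx orbT; lia.
by move=> /parH[a lt]; rewrite /box_adj /= a eqxx; lia.
Qed.

Lemma parent2P : parent_map ((r, s) : box G H) parent2 box_height.
Proof.
move=> [i j]; rewrite /parent2 /box_height /= xpair_eqE andbC.
case: eqVneq => [->|/parH[a lt]] /=; last by rewrite /box_adj /= a eqxx; lia.
by move=> /parG[a lt]; rewrite /box_adj /= a eqxx orbT; lia.
Qed.

Variables (f : labeling (box G H)) (d : nat).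
Hypothesis weight_le :
  forall S, S \in spanning_trees (box G H) -> (`|weight f S| <= d)%N.

Definition turns : {set box G H} :=
  [set v : box G H | [&& v.1 != r, v.2 != s &
    pair_label f v (p v.1, v.2) != pair_label f v (v.1, q v.2)]].

Lemma card_turns : (#|turns| <= d)%N.
Proof.
apply: leq_trans (card_disagree weight_le parent1P parent2P).
apply/subset_leq_card/subsetP => -[i j]; rewrite !inE /= /parent1 /parent2 /=.
by case/and3P => ir js ne; rewrite xpair_eqE (negPf ir) (negPf js) /=.
Qed.

End BoxParent.

(** * Clean rows and columns of the grid *)

Section Grid.
Variable n : nat.
Let k := n.+1.

Definition ord_prev (i : path_graph k) : path_graph k := inord i.-1 : 'I_k.
(** At [ord_max] this is the [inord] default [ord0], harmless because the root needs no parent. *)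
Definition ord_next (i : path_graph k) : path_graph k := inord i.+1 : 'I_k.

Lemma ord_prevP : parent_map (ord0 : path_graph k) ord_prev (fun i => i).
Proof.
move=> i i0; have {}i0 : (0 < i)%N by rewrite lt0n.
have li := ltn_ord i.
by rewrite /= /path_adj /= inordK; [split|]; lia.
Qed.

Lemma ord_nextP : parent_map (ord_max : path_graph k) ord_next (fun i => (n - i)%N).
Proof.
move=> i im; have {}im : (i : nat) <> n by move=> E; case/eqP: im; apply: val_inj.
have li := ltn_ord i.
by rewrite /= /path_adj /= inordK; [split|]; lia.
Qed.

Variables (f : labeling (box (path_graph k) (path_graph k))) (d : nat).
Hypothesis weight_le :
  forall S, S \in spanning_trees _ -> (`|weight f S| <= d)%N.

Let lab (v w : 'I_k * 'I_k) : int := pair_label f v w.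
Let vert (i j : 'I_k) : int := lab (i, j) (ord_prev i, j).
Let horiz (i j : 'I_k) : int := lab (i, j) (i, ord_prev j).

Let turns_ul : {set 'I_k * 'I_k} :=
  @turns (path_graph k) (path_graph k) ord0 ord0 ord_prev ord_prev f.
Let turns_ur : {set 'I_k * 'I_k} :=
  @turns (path_graph k) (path_graph k) ord0 ord_max ord_prev ord_next f.
Let turns_dl : {set 'I_k * 'I_k} :=
  @turns (path_graph k) (path_graph k) ord_max ord0 ord_next ord_prev f.

Definition clean_rows : {set 'I_k} :=
  [set i | (i != ord0) && (i \notin [set v.1 | v in turns_ul :|: turns_ur])].
Definition clean_cols : {set 'I_k} :=
  [set j | (j != ord0) && (j \notin [set v.2 | v in turns_ul :|: turns_dl])].

(** Each exceptional vertex spoils one index, and [ord0] is lost as well, whence [n] and not [k]. *)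
Lemma card_clean (g : 'I_k * 'I_k -> 'I_k) (A B : {set 'I_k * 'I_k}) :
  (#|A| <= d)%N -> (#|B| <= d)%N ->
  (n <= #|[set i | (i != ord0) && (i \notin [set g v | v in A :|: B])]| + 2 * d)%N.
Proof.
move=> Ad Bd.
set X := [set _ | _]; set I := [set _ | _ in _] in X *.
have : (#|~: X| <= 1 + #|I|)%N.
  rewrite -(cards1 (ord0 : 'I_k)); apply: leq_trans (leq_card_setU _ _).
  by apply/subset_leq_card/subsetP => i; rewrite !inE negb_and !negbK.
have : (#|I| <= #|A| + #|B|)%N.
  exact: leq_trans (leq_imset_card _ _) (leq_card_setU _ _).
have := cardsC X; rewrite card_ord /k. move: Ad Bd.
by move: #|X| #|~: X| #|I| #|A| #|B|; lia.
Qed.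

Lemma card_clean_rows : (n <= #|clean_rows| + 2 * d)%N.
Proof.
by apply: card_clean;
  [apply: card_turns ord_prevP ord_prevP _ _ weight_le
  |apply: card_turns ord_prevP ord_nextP _ _ weight_le].
Qed.

Lemma card_clean_cols : (n <= #|clean_cols| + 2 * d)%N.
Proof.
by apply: card_clean;
  [apply: card_turns ord_prevP ord_prevP _ _ weight_le
  |apply: card_turns ord_nextP ord_prevP _ _ weight_le].
Qed.

(** * Labels along clean rows and columns *)

Lemma ord_ind_next (P : 'I_k -> Prop) :
  P ord0 -> (forall i, i != ord_max -> P i -> P (ord_next i)) -> forall i, P i.
Proof.
move=> P0 PS [m mk]; elim: m mk => [|m IH] mk.
  by rewrite (_ : Ordinal mk = ord0) //; apply: val_inj.
have mk' : (m < k)%N by lia.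
have -> : Ordinal mk = ord_next (Ordinal mk') by apply: val_inj; rewrite /= inordK.
by apply: PS (IH mk'); apply/eqP => /(congr1 val) /= E; move: (mk); rewrite E ltnn.
Qed.

Lemma ltn_ord_max (i : 'I_k) : i != ord_max -> (i < n)%N.
Proof.
move=> im; rewrite ltn_neqAle -ltnS ltn_ord andbT.
by apply: contraNneq im => E; apply/eqP/val_inj.
Qed.

Lemma val_ord_next (i : 'I_k) : i != ord_max -> ord_next i = i.+1 :> nat.
Proof. by move=> im; rewrite /ord_next inordK // ltnS ltn_ord_max. Qed.

Lemma ord_next_neq0 (i : 'I_k) : i != ord_max -> ord_next i != ord0.
Proof. by move=> /val_ord_next E; apply/eqP => N; move: E; rewrite N. Qed.

Lemma ord_nextK (i : 'I_k) : i != ord_max -> ord_prev (ord_next i) = i.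
Proof.
by move=> im; rewrite /ord_prev val_ord_next // inord_val.
Qed.

Lemma clean_row_horiz (i j : 'I_k) : i \in clean_rows -> j != ord0 ->
  vert i j = horiz i j.
Proof.
rewrite inE => /andP[i0 cl] j0; apply/eqP; apply: contraNT cl => ne.
by apply/imsetP; exists (i, j); rewrite // inE; apply/orP; left; rewrite inE /= i0 j0.
Qed.

(** A horizontal edge is the left edge of one end and the right edge of the other, so it agrees with
    the upward edges at both ends. *)
Lemma clean_row_vert (i j : 'I_k) : i \in clean_rows -> vert i j = vert i ord0.
Proof.
move=> cl; elim/ord_ind_next: j => // j jm <-.
rewrite clean_row_horiz ?ord_next_neq0 // /horiz ord_nextK // /lab pair_labelC.
apply/esym/eqP; move: cl; rewrite inE => /andP[i0]; apply: contraNT => ne.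
by apply/imsetP; exists (i, j); rewrite // inE; apply/orP; right; rewrite inE /= i0 jm.
Qed.

(** A vertical edge agrees with the left edges at both ends: no turn towards the upper left at its
    lower end, none towards the lower left at its upper end. *)
Lemma clean_col_horiz (i j : 'I_k) : j \in clean_cols -> horiz i j = horiz ord0 j.
Proof.
rewrite inE => /andP[j0 cl]; elim/ord_ind_next: i => // i im <-.
transitivity (vert (ord_next i) j).
  apply/esym/eqP; apply: contraNT cl => ne.
  apply/imsetP; exists (ord_next i, j); rewrite // inE; apply/orP; left.
  by rewrite inE /= j0 ord_next_neq0.
rewrite /vert ord_nextK // /lab pair_labelC.
apply/eqP; apply: contraNT cl => ne.
by apply/imsetP; exists (i, j); rewrite // inE; apply/orP; right; rewrite inE /= j0 im.
Qed.

(** * Weight of the leftward tree *)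

Lemma clean_weight : (0 < #|clean_cols|)%N ->
  2 * k%:Z * #|clean_rows|%:Z - k%:Z ^+ 2 + 1 <= d%:Z.
Proof.
case/card_gt0P => j jc.
have j0 : j != ord0 by move: jc; rewrite inE => /andP[].
have P := parent2P ord_prevP ord_prevP.
set s := horiz ord0 j.
have s1 : s = 1 \/ s = -1.
  have [|a _] := P (ord0, j); first by rewrite xpair_eqE negb_and j0 orbT.
  by apply: pair_labelP; move: a; rewrite /parent2 /= (negPf j0).
(* The left edge at the crossing with column [j] carries both the label of the row and that of the
   column. *)
have row_vert i j' : i \in clean_rows -> vert i j' = s.
  move=> ic; rewrite /s -(clean_col_horiz i jc) -clean_row_horiz //.
  by rewrite clean_row_vert // [RHS]clean_row_vert.
have := parent_sum_le weight_le P.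
set S := \sum_(v | _) _.
suff : 2 * k%:Z * #|clean_rows|%:Z - k%:Z ^+ 2 + 1 <= s * S.
  by case: s1 => ->; lia.
rewrite /S mulr_sumr.
(* A lower bound for the contribution of [v] to [s * S]: 1 in a clean row, -1 elsewhere. Omitting
   the corner, whose row is not clean, gives the final +1. *)
pose t (v : 'I_k * 'I_k) : int := 2 * (v.1 \in clean_rows)%:R - 1.
have -> : 2 * k%:Z * #|clean_rows|%:Z - k%:Z ^+ 2 + 1 =
   \sum_(v | v != (ord0, ord0)) t v.
  have -> : \sum_(v | v != (ord0, ord0)) t v = \sum_v t v + 1.
    rewrite [in RHS](bigD1 (ord0, ord0)) //= {2}/t /=.
    by rewrite inE eqxx mulr0 sub0r addrAC addNr add0r.
  congr (_ + 1); rewrite sumrB -mulr_sumr sumr_const card_prod card_ord.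
  rewrite -(pair_bigA _ (fun i _ => (i \in clean_rows)%:R)) /=.
  under eq_bigr do rewrite sumr_const card_ord.
  rewrite sumrMnl -natr_sum -big_mkcond sum1_card /=.
  by rewrite -mulr_natr natrM !natz; ring.
apply: ler_sum => -[i j'] v0; rewrite {}/t /=.
have [/pair_labelP ab _] := P _ v0.
case: (boolP (i \in clean_rows)) => ic.
  set x := pair_label _ _ _; suff -> : x = s by case: s1 => ->; lia.
  rewrite /x -(row_vert i j' ic) /parent2 /=; case: eqVneq => [->//|j0'].
  by rewrite clean_row_horiz.
by case: s1 => ->; case: (ab f) => ->; lia.
Qed.

Lemma grid_bound : (0 < n)%N -> (k <= 20 * d)%N.
Proof.
move=> n0; have := card_clean_cols; have := card_clean_rows => cr cc.
(* Without a clean column, [n <= 2 * d], hence [k <= 2 * n <= 4 * d]. *)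
have [c0|/clean_weight cw] := posnP #|clean_cols|; first by rewrite /k; lia.
rewrite leqNgt; apply/negP; move: cw cr; rewrite /k; move: #|clean_rows| => C cw cr lt.
(* With [C >= n - 2d], [cw] yields [n^2 <= (4n + 5)d]. But [20d <= n] bounds the right side by
   [n^2/5 + n/4 < n^2]. *)
have m1 : (n.+1 * n <= n.+1 * (C + 2 * d))%N by rewrite leq_mul2l cr orbT.
have m2 : (n * (20 * d) <= n * n)%N by rewrite leq_mul2l -ltnS lt orbT.
have m3 : (n <= n * n)%N by rewrite leq_pmulr.
clear cc cr; move: cw; nia.
Qed.

End Grid.

Theorem theorem1p5 (R : realType) :
  exists2 c : R, 0 < c &
    forall k : nat, (2 <= k)%N ->
      c * k%:R <=
        (discrepancy (spanning_trees (box (path_graph k) (path_graph k))))%:R.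
Proof.
exists 20%:R^-1; first by rewrite invr_gt0 ltr0n.
case=> // n n1; rewrite mulrC ler_pdivrMr ?ltr0n // -natrM ler_nat mulnC.
set F := spanning_trees _; set d := discrepancy F.
(* For a minimizing labeling, [d] is by definition the largest absolute tree weight. *)
pose f := [arg min_(f < [ffun=> label1] : labeling _) max_weight F f].
apply: (@grid_bound n f d) => // S SF.
exact: (@leq_bigmax_cond _ (mem F) (fun S => `|weight f S|%N)).
Qed.
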